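(* Let $(\phi_d)_{d\ge0}$ be a sequence of measurable embeddings $\phi_d:\mathcal X\times\mathcal Y\to\mathbb R^d$ with $\mathcal G_d\subseteq\mathcal G_{d+1}$ for all $d\ge 0$, where $\mathcal G_d$ is the sigma-field on $\mathcal X\times\mathcal Y^2$ generated by $(x,y,y')\mapsto(\phi_d(x,y),\phi_d(x,y'))$. Assume $\phi_0$ is constant. Then for every $\delta\in(0,\tfrac14)$: 1. $\bar P_0^\delta=0$; 2. for all $d\ge0$, $\bar P_d^\delta\ge\bar P_\infty^{\inf,2\delta}-\frac{3}{\delta^2}e_d$; 3. the map $d\mapsto\bar P_\infty^{\inf,2\delta}-\frac3{\delta^2}e_d$ is non-decreasing in $d$.
   Context: $\mathcal X$ (prompts) and $\mathcal Y$ (responses) are measurable spaces, $\nu$ is a probability measure on $\mathcal X$, and for each $x$, $\mu_x$ is a probability measure on $\mathcal Y$ (a probability kernel in $x$). There are $n\ge1$ annotators with measurable utilities $u_i:\mathcal X\times\mathcal Y\to\mathbb R$. Let $F(t)=1/(1+e^{-t})$ and $\bar p(x,y,y')=\frac1n\sum_{i=1}^nF(u_i(x,y)-u_i(x,y'))$. $\tilde p_{\phi_d}(x,y,y')=\mathbb E_{(y_0,y_0')\sim\mu_x^{\otimes2}}[\bar p(x,y_0,y_0')\mid\phi_d(x,y_0)=\phi_d(x,y),\ \phi_d(x,y_0')=\phi_d(x,y')]$, and $e_d=\mathbb E_{x\sim\nu}\mathbb E_{(y,y')\sim\mu_x^{\otimes2}}[(\bar p-\tilde p_{\phi_d})^2]$.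 $\eta_d=\min\{\tilde p_{\phi_d},1-\tilde p_{\phi_d}\}$, $\kappa_d=\eta_d(1-\eta_d)$, $\kappa_d^{\min}(x,y_1,y_2,y_3)=\min\{\kappa_d(x,y_1,y_2),\kappa_d(x,y_2,y_3),\kappa_d(x,y_3,y_1)\}$. For $\gamma\in(0,\frac12)$, $\mathcal{CC}_d^\gamma$ is the event that $\tilde p_{\phi_d}(x,y_1,y_2),\tilde p_{\phi_d}(x,y_2,y_3),\tilde p_{\phi_d}(x,y_3,y_1)$ are all $\ge\frac12+\gamma$ or all $\le\frac12-\gamma$; $\mathcal{CC}_\infty^\gamma$ is the same event with $\bar p$ in place of $\tilde p_{\phi_d}$. Define $$\bar P_d^\gamma=\mathbb E_{x\sim\nu}\mathbb E_{(y_1,y_2,y_3)\sim\mu_x^{\otimes3}}[\kappa_d^{\min}\,\mathbf 1_{\mathcal{CC}_d^\gamma}],\qquad \bar P_\infty^{\inf,\gamma}=\inf_{d\ge0}\mathbb E_{x\sim\nu}\mathbb E_{(y_1,y_2,y_3)\sim\mu_x^{\otimes3}}[\kappa_d^{\min}\,\mathbf 1_{\mathcal{CC}_\infty^\gamma}].$$ *)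

(* Defs.v *)
From HB Require Import structures.
From mathcomp Require Import all_boot all_order all_algebra.
From mathcomp Require Import all_classical all_reals all_analysis.

Set Implicit Arguments.
Unset Strict Implicit.
Unset Printing Implicit Defensive.

Import Order.TTheory GRing.Theory Num.Theory.
Import numFieldNormedType.Exports.

Local Open Scope classical_set_scope.
Local Open Scope ring_scope.

Section CondExp.
Context {d : measure_display} {T : measurableType d} {R : realType}.

(* g is a version of the conditional expectation of f given the sigma-field G,
   under the measure P. *)
Definition is_cond_exp (P : set T -> \bar R) (G : set (set T)) (f g : T -> R)
    : Prop :=
  [/\ forall B : set R, measurable B -> G (g @^-1` B),
      P.-integrable setT (EFin \o g)
    & forall A : set T, G A ->
        (\int[P]_(z in A) (g z)%:E = \int[P]_(z in A) (f z)%:E)%E].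

End CondExp.

Definition logistic {R : realType} (t : R) : R := (1 + expR (- t))^-1.

Section Preferences.
Context {dX dY : measure_display} {X : measurableType dX}
  {Y : measurableType dY} {R : realType}.

(* A triple (x, y, y') is encoded as (x, (y, y')) : X * (Y * Y). *)

Definition mean_pref (n : nat) (u : 'I_n -> X * Y -> R) (w : X * (Y * Y)) : R :=
  n%:R^-1 *
  \sum_(i < n) logistic (u i (w.1, w.2.1) - u i (w.1, w.2.2)).

Definition pair_emb {V : Type} (f : X * Y -> V) (w : X * (Y * Y)) : V * V :=
  (f (w.1, w.2.1), f (w.1, w.2.2)).

Variables (nu : probability X R) (mu : R.-pker X ~> Y).

(* q is a version of p~_f: jointly measurable and, for nu-almost every x, q(x, .)
   is a version of the conditional expectation of p(x, .) under mu_x (x) mu_x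
   given (f(x, y), f(x, y')).  The conditioning is done at fixed x.  All the
   expectations below take the same value for every version. *)
Definition is_emb_pref {dV : measure_display} {V : measurableType dV}
    (f : X * Y -> V) (p q : X * (Y * Y) -> R) : Prop :=
  measurable_fun setT q /\
  {ae nu, forall x : X,
    is_cond_exp (mu x \x mu x)%E
      (g_sigma_algebra_preimage (fun z : Y * Y => pair_emb f (x, z)))
      (fun z => p (x, z)) (fun z => q (x, z))}.

Definition mse (p q : X * (Y * Y) -> R) : \bar R :=
  (\int[nu]_x \int[mu x \x mu x]_z ((p (x, z) - q (x, z)) ^+ 2)%:E)%E.

Definition eta (q : X * (Y * Y) -> R) (w : X * (Y * Y)) : R :=
  Num.min (q w) (1 - q w).

Definition kappa (q : X * (Y * Y) -> R) (w : X * (Y * Y)) : R :=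
  eta q w * (1 - eta q w).

(* (x, y1, y2, y3) is encoded as (x, (y1, y2, y3)), with
   (y1, y2, y3) = ((y1, y2), y3). *)
Definition pair12 (t : X * (Y * Y * Y)) : X * (Y * Y) :=
  (t.1, (t.2.1.1, t.2.1.2)).
Definition pair23 (t : X * (Y * Y * Y)) : X * (Y * Y) :=
  (t.1, (t.2.1.2, t.2.2)).
Definition pair31 (t : X * (Y * Y * Y)) : X * (Y * Y) :=
  (t.1, (t.2.2, t.2.1.1)).

Definition kappa_min (q : X * (Y * Y) -> R) (t : X * (Y * Y * Y)) : R :=
  Num.min (kappa q (pair12 t)) (Num.min (kappa q (pair23 t)) (kappa q (pair31 t))).

Definition CC (gamma : R) (q : X * (Y * Y) -> R) : set (X * (Y * Y * Y)) :=
  [set t | [/\ 2^-1 + gamma <= q (pair12 t), 2^-1 + gamma <= q (pair23 t)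
             & 2^-1 + gamma <= q (pair31 t)]
        \/ [/\ q (pair12 t) <= 2^-1 - gamma, q (pair23 t) <= 2^-1 - gamma
             & q (pair31 t) <= 2^-1 - gamma]].

Definition cyc_kappa (gamma : R) (q r : X * (Y * Y) -> R) : \bar R :=
  (\int[nu]_x \int[(mu x \x mu x) \x mu x]_z
     (kappa_min q (x, z) * \1_(CC gamma r) (x, z))%:E)%E.

Definition Pbar (gamma : R) (pt : nat -> X * (Y * Y) -> R) (d : nat) : \bar R :=
  cyc_kappa gamma (pt d) (pt d).

Definition Pbar_inf (gamma : R) (p : X * (Y * Y) -> R)
    (pt : nat -> X * (Y * Y) -> R) : \bar R :=
  ereal_inf (range (fun d : nat => cyc_kappa gamma (pt d) p)).

End Preferences.

(* Main.v *)
Require Import Defs.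
From HB Require Import structures.
From mathcomp Require Import all_boot all_order all_algebra.
From mathcomp Require Import all_classical all_reals all_analysis.
From mathcomp Require Import measurable_realfun ring lra.

(** At a fixed prompt, [q_d = pt d] is the L2-projection of the mean preference
    [p] onto the functions measurable with respect to the sigma-field of
    [phi d]; these sigma-fields increase with [d], so the mean square errors
    [e_d] decrease.  If [t] lies in the event [CC (2 delta) p] but not in
    [CC delta q_d], then one of the three pairs of [t] has [|p - q_d| >= delta],
    and Markov's inequality on each pair bounds the loss by [3 e_d / delta^2].
    For [d = 0] the projection is the constant [1/2], because
    [p (x, (y, y')) + p (x, (y', y)) = 1], and the event is empty.

    A version of a conditional expectation takes its values in [[0, 1]] only
    almost everywhere, so every [pt d] is first truncated to [[0, 1]]; this
    changes none of the integrals. *)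

Set Implicit Arguments.
Unset Strict Implicit.
Unset Printing Implicit Defensive.

Import Order.TTheory GRing.Theory Num.Theory.
Import numFieldNormedType.Exports.

Local Open Scope classical_set_scope.
Local Open Scope ring_scope.

(** * Auxiliary facts on integrals *)

(* Writing [h z] as the Lebesgue measure of [`[0, h z[] reduces products with a
   function [h] to integrals over its superlevel sets, which lie in the
   sigma-field of [h]: no approximation by simple functions is needed. *)
Lemma ge0_integral_mul_layer_cake d (T : measurableType d) (R : realType)
    (P : {sigma_finite_measure set T -> \bar R}) (f h : T -> R) :
  measurable_fun setT f -> measurable_fun setT h ->
  (forall z, 0 <= f z) -> (forall z, 0 <= h z) ->
  (\int[P]_z (f z * h z)%:E =
   \int[lebesgue_measure]_(t in `[0%R, +oo[)
     \int[P]_(z in h @^-1` `]t, +oo[) (f z)%:E)%E.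
Proof.
move=> mf mh f0 h0.
(* The region under the graph of [h]: its section over [z] has length [h z], and its section at a
   height [t >= 0] is a superlevel set, so Tonelli for [f] times its indicator links the two
   sides. *)
pose A := [set w : T * R | 0 <= w.2 < h w.1].
have mA : measurable A.
  have mg : measurable_fun setT (fun w : T * R => 0 <= w.2 < h w.1).
    apply: measurable_and; first exact: measurable_fun_ler.
    by apply: measurable_fun_ltr => //; exact: measurableT_comp.
  have := mg measurableT [set true] I.
  by congr measurable; apply/seteqP; split => w /=; [case|].
pose k : T * R -> \bar R := EFin \o (fun w => f w.1 * \1_A w).
have mk : measurable_fun setT k.
  apply/measurable_EFinP; apply: measurable_funM.
    exact: measurableT_comp.
  exact: measurable_indic.
have k0 w : (0 <= k w)%E by rewrite lee_fin mulr_ge0.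
transitivity (\int[P]_z \int[lebesgue_measure]_t k (z, t))%E.
  apply: eq_integral => z _; rewrite /k /=.
  under eq_integral do rewrite EFinM.
  rewrite ge0_integralZl_EFin//; last first.
    apply/measurable_EFinP; exact: (measurableT_comp (measurable_indic mA)).
  have -> : (\int[lebesgue_measure]_t (\1_A (z, t))%:E =
      \int[lebesgue_measure]_t (\1_(`[0%R, h z[%classic : set R) t)%:E)%E.
    apply: eq_integral => t _; congr (_%:E).
  rewrite integral_indic// setIT /= lebesgue_measure_itv /= lte_fin.
  have [h1|h1] := ltP 0 (h z); first by rewrite sube0.
  have -> : h z = 0 by apply/eqP; rewrite eq_le h1 h0.
  by rewrite mulr0 mule0.
transitivity (\int[lebesgue_measure]_t \int[P]_z k (z, t))%E.
  exact: fubini_tonelli.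
rewrite [RHS]integral_mkcond; apply: eq_integral => t _.
rewrite patchE; case: ifPn => [|] t0; last first.
  rewrite integral0_eq// => z _; rewrite /k /= indicE.
  rewrite (_ : (_, _) \in A = false) ?mulr0//.
  apply/negbTE; apply: contra t0; rewrite !inE /A/= in_itv/= andbT => /andP[]//.
rewrite [RHS]integral_mkcond; apply: eq_integral => z _.
rewrite patchE /k /= indicE.
move: t0; rewrite inE/= in_itv/= andbT => t0.
rewrite (_ : ((z, t) \in A) = (t < h z)); last first.
  by apply/idP/idP; rewrite inE /A /= t0.
rewrite (_ : (z \in _) = (t < h z)); last first.
  by apply/idP/idP; rewrite inE /= in_itv/= andbT.
by case: ifP; rewrite ?mulr1 ?mulr0.
Qed.

Lemma bounded_prob_integrable d (T : measurableType d) (R : realType)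
    (P : probability T R) (f : T -> R) (M : R) :
  measurable_fun setT f -> (forall z, `|f z| <= M) ->
  P.-integrable setT (EFin \o f).
Proof.
move=> mf fM; apply: measurable_bounded_integrable => //.
  by rewrite (@le_lt_trans _ _ 1%E) ?ltry// probability_le1.
exists M; split; first by rewrite num_real.
by move=> x Mx z _; exact: le_trans (fM z) (ltW Mx).
Qed.

(** The nonnegative function [g - f] has integral zero over [A], so it vanishes almost everywhere
    there, yet it is positive at every point of [A]. *)
Lemma integral_eq_lt_null d (T : measurableType d) (R : realType)
    (P : {measure set T -> \bar R}) (A : set T) (f g : T -> R) :
  measurable A -> P.-integrable setT (EFin \o f) ->
  P.-integrable setT (EFin \o g) ->
  (\int[P]_(z in A) (f z)%:E = \int[P]_(z in A) (g z)%:E)%E ->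
  (forall z, A z -> f z < g z) -> P A = 0%E.
Proof.
move=> mA iF ig fg lfg.
have iFA : P.-integrable A (EFin \o f) by apply: integrableS iF.
have igA : P.-integrable A (EFin \o g) by apply: integrableS ig.
have : (\int[P]_(z in A) `|(g z)%:E - (f z)%:E| = 0)%E.
  under eq_integral.
    move=> z; rewrite inE => Az.
    rewrite gee0_abs; last by rewrite -EFinB lee_fin subr_ge0 ltW// lfg.
    over.
  rewrite integralB_EFin// fg subee//.
  by have := integrable_fin_num mA igA.
move/ae_eq_integral_abs => /(_ mA).
have mgf : measurable_fun A (fun z => ((g z)%:E - (f z)%:E)%E).
  by apply: emeasurable_funB; [case/integrableP: igA|case/integrableP: iFA].
move=> /(_ mgf) H.
apply/negligibleP => //; apply: negligibleS H => z Az /=.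
move=> /(_ Az) /eqP; rewrite -EFinB eqe subr_eq0 => /eqP h.
by have := lfg _ Az; rewrite h ltxx.
Qed.

(** * Truncation and conditional expectation *)

Definition clamp01 {R : realType} (x : R) : R := Num.max 0 (Num.min 1 x).

Lemma clamp01_itv (R : realType) (x : R) : 0 <= clamp01 x <= 1.
Proof. by rewrite /clamp01 le_max lexx ge_max ler01 ge_min lexx. Qed.

Lemma clamp01_id (R : realType) (x : R) : 0 <= x <= 1 -> clamp01 x = x.
Proof. by move=> /andP[x0 x1]; rewrite /clamp01 (min_idPr x1) (max_idPr x0). Qed.

Lemma measurable_clamp01 (R : realType) : measurable_fun setT (@clamp01 R).
Proof. by apply: measurable_maxr => //; exact: measurable_minr. Qed.

Section cond_exp.
Context d (T : measurableType d) (R : realType) (P : probability T R).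
Variable G : set (set T).
Hypothesis GM : G `<=` measurable.

(** The events [g < 0] and [g > 1] belong to [G], so [f] and [g] have equal integrals over each. But
    [g] is strictly below [f] on the first and strictly above it on the second, so both are null. *)
Lemma cond_exp_clamp01_ae (f g : T -> R) :
  measurable_fun setT f -> (forall z, 0 <= f z <= 1) -> is_cond_exp P G f g ->
  ae_eq P setT g (clamp01 \o g).
Proof.
move=> mf f01 [Gg ig fg].
have iF : P.-integrable setT (EFin \o f).
  apply: (@bounded_prob_integrable _ _ _ _ _ 1) => // z.
  by have /andP[f0 f1] := f01 z; rewrite ger0_norm.
have G0 : G (g @^-1` `]-oo, 0[) by apply: Gg; exact: measurable_itv.
have G1 : G (g @^-1` `]1, +oo[) by apply: Gg; exact: measurable_itv.
have N0 : P (g @^-1` `]-oo, 0[) = 0%E.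
  apply: (integral_eq_lt_null (GM G0) ig iF (fg _ G0)) => z /=.
  by rewrite in_itv/= => g0; have /andP[f0 _] := f01 z; exact: (lt_le_trans g0 f0).
have N1 : P (g @^-1` `]1, +oo[) = 0%E.
  apply: (integral_eq_lt_null (GM G1) iF ig (esym (fg _ G1))) => z /=.
  rewrite in_itv/= andbT => g0; have /andP[_ f1] := f01 z; exact: le_lt_trans f1 g0.
have N : P.-negligible (g @^-1` `]-oo, 0[ `|` g @^-1` `]1, +oo[).
  by apply: negligibleU; apply/negligibleP => //; exact: GM.
apply: negligibleS N => z /=; rewrite !in_itv/= andbT.
have [?|z0] := ltP (g z) 0; first by left.
have [?|z1] := ltP 1 (g z); first by right.
by move=> []; rewrite clamp01_id// z0.
Qed.

(** Truncation is a Borel map, which preserves measurability for [G], and integrals do not see a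
    change on a null set. *)
Lemma is_cond_exp_clamp01 (f g : T -> R) :
  measurable_fun setT f -> (forall z, 0 <= f z <= 1) -> is_cond_exp P G f g ->
  is_cond_exp P G f (clamp01 \o g).
Proof.
move=> mf f01 fg; have ggc := cond_exp_clamp01_ae mf f01 fg.
case: fg => Gg ig fg.
have mg : measurable_fun setT g by apply/measurable_EFinP; case/integrableP: ig.
have mgc : measurable_fun setT (clamp01 \o g).
  by apply: measurableT_comp mg; exact: measurable_clamp01.
split.
- move=> B mB; rewrite comp_preimage; apply: Gg.
  by rewrite -[X in measurable X]setTI; exact: measurable_clamp01.
- apply: (@bounded_prob_integrable _ _ _ _ _ 1) => // z.
  by have /andP[? ?] := clamp01_itv (g z); rewrite ger0_norm.
- move=> A GA; rewrite -fg//; apply: ae_eq_integral => //.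
  + exact: GM.
  + by apply/measurable_EFinP; exact: measurable_funTS.
  + by apply/measurable_EFinP; exact: measurable_funTS.
  + apply: negligibleS ggc => z /= H H1; apply: H => Az.
    by rewrite -H1.
Qed.

(** In layer-cake form both sides involve only integrals over superlevel sets of [h]; these sets
    belong to [G], where [f] and [g] integrate alike. *)
Lemma cond_exp_mul (f g h : T -> R) :
  measurable_fun setT f -> (forall z, 0 <= f z) -> (forall z, 0 <= g z) ->
  is_cond_exp P G f g ->
  (forall B, measurable B -> G (h @^-1` B)) -> (forall z, 0 <= h z) ->
  (\int[P]_z (g z * h z)%:E = \int[P]_z (f z * h z)%:E)%E.
Proof.
move=> mf f0 g0 [_ ig fg] Gh h0.
have mg : measurable_fun setT g by apply/measurable_EFinP; case/integrableP: ig.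
have mh : measurable_fun setT h by move=> _ B mB; rewrite setTI; exact/GM/Gh.
rewrite !ge0_integral_mul_layer_cake//; apply: eq_integral => t _.
apply: fg; apply: Gh; exact: measurable_itv.
Qed.

(** Pythagoras: [f - g] is orthogonal to [g - h], so the two sides differ by the integral of
    [(g - h) ^+ 2]. *)
Lemma cond_exp_l2_proj (f g h : T -> R) :
  measurable_fun setT f -> (forall z, 0 <= f z <= 1) ->
  (forall z, 0 <= g z <= 1) -> is_cond_exp P G f g ->
  (forall B, measurable B -> G (h @^-1` B)) -> (forall z, 0 <= h z <= 1) ->
  (\int[P]_z ((f z - g z) ^+ 2)%:E <= \int[P]_z ((f z - h z) ^+ 2)%:E)%E.
Proof.
move=> mf f01 g01 fg Gh h01.
have f0 z : 0 <= f z by case/andP: (f01 z).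
have g0 z : 0 <= g z by case/andP: (g01 z).
have h0 z : 0 <= h z by case/andP: (h01 z).
have mg : measurable_fun setT g.
  by apply/measurable_EFinP; case: fg => _ /integrableP[].
have mh : measurable_fun setT h by move=> _ B mB; rewrite setTI; exact/GM/Gh.
have Gg B : measurable B -> G (g @^-1` B) by case: fg => + _ _; exact.
have bnd (a : T -> R) : (forall z, 0 <= a z <= 1) -> forall z, `|a z| <= 1.
  by move=> a01 z; have /andP[? ?] := a01 z; rewrite ger0_norm.
have iM (a b : T -> R) : measurable_fun setT a -> measurable_fun setT b ->
    (forall z, 0 <= a z <= 1) -> (forall z, 0 <= b z <= 1) ->
    P.-integrable setT (EFin \o (fun z => a z * b z)).
  move=> ma mb a01 b01; apply: (@bounded_prob_integrable _ _ _ _ _ 1).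
    exact: measurable_funM.
  by move=> z; rewrite normrM mulr_ile1// bnd.
have iS (a b : T -> R) : measurable_fun setT a -> measurable_fun setT b ->
    (forall z, 0 <= a z <= 1) -> (forall z, 0 <= b z <= 1) ->
    P.-integrable setT (EFin \o (fun z => (a z - b z) ^+ 2)).
  move=> ma mb a01 b01; apply: (@bounded_prob_integrable _ _ _ _ _ 1).
    by apply: measurable_funX; exact: measurable_funB.
  move=> z; have /andP[? ?] := a01 z; have /andP[? ?] := b01 z.
  by rewrite normrX exprn_ile1// ler_norml; apply/andP; split; lra.
have fgh := cond_exp_mul mf f0 g0 fg Gh h0.
have fgg := cond_exp_mul mf f0 g0 fg Gg g0.
(* The cross term [2 (f - g) (g - h)] is expanded into two differences, which [cond_exp_mul] cancels
   with the multipliers [g] and [h]. *)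
have key : (\int[P]_z ((f z - h z) ^+ 2)%:E =
    \int[P]_z ((f z - g z) ^+ 2)%:E + \int[P]_z ((g z - h z) ^+ 2)%:E
    + 2%:E * (\int[P]_z (f z * g z)%:E - \int[P]_z (g z * g z)%:E)
    + 2%:E * (\int[P]_z (g z * h z)%:E - \int[P]_z (f z * h z)%:E))%E.
{ rewrite -!integralB_EFin//; [|exact: iM..].
  rewrite -!integralZl//; [|by apply: integrableB => //; exact: iM..].
  rewrite -!integralD//.
    apply: eq_integral => z _; rewrite -!EFinB -!EFinM -!EFinD; congr EFin.
    by ring.
  all: do ?[apply: integrableD => //|apply: integrableZl => //].
  all: first [exact: iS|exact: iM|apply: integrableN; exact: iM]. }
(* Cancelling with [subee] requires finite integrals; the last two goals provide this. *)
rewrite key fgg fgh !subee ?mule0 ?adde0 ?leeDl//.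
- by apply: integral_ge0 => z _; rewrite lee_fin sqr_ge0.
- exact: (integrable_fin_num _ (iM _ _ mf mh f01 h01)).
- exact: (integrable_fin_num _ (iM _ _ mf mg f01 g01)).
Qed.
End cond_exp.

(** * Marginals of product measures *)

Section product_marginals.
Context d (Y : measurableType d) (R : realType) (P : probability Y R).
Local Open Scope ereal_scope.

Lemma integral_prob_cst (c : \bar R) : \int[P]_y c = c.
Proof.
transitivity (\int[P]_y cst c y) => //.
rewrite integral_cst// [X in _ * X](probability_setT P) ?mule1//.
Qed.

Lemma ge0_integral_swap (f : Y * Y -> \bar R) :
  measurable_fun setT f -> (forall z, 0 <= f z) ->
  \int[P \x P]_z f (z.2, z.1) = \int[P \x P]_z f z.
Proof.
move=> mf f0.
have ms : measurable_fun setT (fun z : Y * Y => (z.2, z.1)).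
  exact: measurable_fun_pair.
rewrite fubini_tonelli1//; last exact: measurableT_comp mf ms.
by rewrite fubini_tonelli2.
Qed.

(** The ascription packages the product as a probability, so that it can serve as a factor in the
    Tonelli lemmas. *)
Let PP : probability (Y * Y)%type R := (P \x P).

(** Together with the two analogues below, this makes the three cyclic pairs of a random triple
    equidistributed. This yields the constant 3 in the error term and carries null sets of pairs
    over to triples. *)
Lemma ge0_integral_marg12 (f : Y * Y -> \bar R) :
  measurable_fun setT f -> (forall z, 0 <= f z) ->
  \int[(P \x P) \x P]_t f (t.1.1, t.1.2) = \int[P \x P]_z f z.
Proof.
move=> mf f0.
pose g (t : Y * Y * Y) := f (t.1.1, t.1.2).
have mg : measurable_fun setT g.
  apply: (measurableT_comp mf); apply: measurable_fun_pair;
  exact: measurableT_comp.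
have g0 t : 0 <= g t by exact: f0.
transitivity (\int[PP]_z fubini_F P g z).
  exact: (@fubini_tonelli1 _ _ _ _ _ PP P g mg g0).
apply: eq_integral => -[y1 y2] _.
exact: (integral_prob_cst (f (y1, y2))).
Qed.

Lemma ge0_integral_marg23 (f : Y * Y -> \bar R) :
  measurable_fun setT f -> (forall z, 0 <= f z) ->
  \int[(P \x P) \x P]_t f (t.1.2, t.2) = \int[P \x P]_z f z.
Proof.
move=> mf f0.
pose g (t : Y * Y * Y) := f (t.1.2, t.2).
have mg : measurable_fun setT g.
  apply: (measurableT_comp mf); apply: measurable_fun_pair => //.
  exact: measurableT_comp.
have g0 t : 0 <= g t by exact: f0.
transitivity (\int[PP]_z fubini_F P g z).
  exact: (@fubini_tonelli1 _ _ _ _ _ PP P g mg g0).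
pose G := fubini_F P g.
have mG : measurable_fun setT G by exact: measurable_fun_fubini_tonelli_F.
have G0 z : 0 <= G z by exact: integral_ge0.
(* [G] does not depend on the first response, so that one is integrated innermost. *)
transitivity (\int[P]_y fubini_G P G y).
  exact: (@fubini_tonelli2 _ _ _ _ _ P P G mG G0).
rewrite [RHS](@fubini_tonelli1 _ _ _ _ _ P P f mf f0).
apply: eq_integral => y _.
exact: (integral_prob_cst (\int[P]_z f (y, z))).
Qed.

Lemma ge0_integral_marg31 (f : Y * Y -> \bar R) :
  measurable_fun setT f -> (forall z, 0 <= f z) ->
  \int[(P \x P) \x P]_t f (t.2, t.1.1) = \int[P \x P]_z f z.
Proof.
move=> mf f0.
pose g (t : Y * Y * Y) := f (t.2, t.1.1).
have mg : measurable_fun setT g.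
  apply: (measurableT_comp mf); apply: measurable_fun_pair => //.
  exact: measurableT_comp.
have g0 t : 0 <= g t by exact: f0.
transitivity (\int[PP]_z fubini_F P g z).
  exact: (@fubini_tonelli1 _ _ _ _ _ PP P g mg g0).
pose G := fubini_F P g.
have mG : measurable_fun setT G by exact: measurable_fun_fubini_tonelli_F.
have G0 z : 0 <= G z by exact: integral_ge0.
transitivity (\int[P]_y fubini_F P G y).
  exact: (@fubini_tonelli1 _ _ _ _ _ P P G mG G0).
(* The pair reverses the order of the coordinates, hence the other order of integration on the
   right. *)
rewrite [RHS](@fubini_tonelli2 _ _ _ _ _ P P f mf f0).
apply: eq_integral => y _.
exact: (integral_prob_cst (\int[P]_z f (z, y))).
Qed.

End product_marginals.

(* [h] maps [m] to [m'], expressed through integrals as in [ge0_integral_marg12]. *)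
Lemma ae_comp_of_integral d d' (S : measurableType d) (T : measurableType d')
    (R : realType) (m : {measure set S -> \bar R}) (m' : {measure set T -> \bar R})
    (h : S -> T) (Q : T -> Prop) :
  measurable_fun setT h ->
  (forall f : T -> \bar R, measurable_fun setT f -> (forall z, 0 <= f z)%E ->
    \int[m]_t f (h t) = \int[m']_z f z)%E ->
  {ae m', forall z, Q z} -> {ae m, forall t, Q (h t)}.
Proof.
move=> mh mm' [N [mN N0 QN]].
have mhN : measurable (h @^-1` N) by rewrite -[X in measurable X]setTI; exact: mh.
exists (h @^-1` N); split => //; last by move=> t Qt; exact: QN.
transitivity (\int[m]_t (\1_(h @^-1` N) t)%:E)%E.
  by rewrite integral_indic// setIT.
transitivity (\int[m']_z (\1_N z)%:E)%E.
  apply: (mm' (EFin \o \1_N)) => [|z]; last by rewrite lee_fin.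
  by apply/measurable_EFinP; exact: measurable_indic.
by rewrite integral_indic// setIT.
Qed.

(** * Integration against probability kernels *)

(* The kernel is composed with [h] to integrate a function of further parameters
   [w : W] against [k (h w)]. *)
Section kernel_integral.
Context dW dX dZ (W : measurableType dW) (X : measurableType dX)
  (Z : measurableType dZ) (R : realType).
Variables (k : R.-pker X ~> Z) (h : W -> X) (mh : measurable_fun setT h).

Let kh (w : W) : {measure set Z -> \bar R} := k (h w).

Let measurable_kh U : measurable U -> measurable_fun setT (kh ^~ U).
Proof. by move=> mU; exact: (measurableT_comp (measurable_kernel k U mU) mh). Qed.

HB.instance Definition _ := isKernel.Build _ _ _ _ _ kh measurable_kh.

Let kh_setT w : kh w setT = 1%E.
Proof. exact: prob_kernel. Qed.

HB.instance Definition _ := Kernel_isProbability.Build _ _ _ _ _ kh kh_setT.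

Lemma measurable_fun_integral_kernel_comp (f : W * Z -> \bar R) :
  (forall z, 0 <= f z)%E -> measurable_fun setT f ->
  measurable_fun setT (fun w => \int[k (h w)]_z f (w, z))%E.
Proof.
move=> f0 mf.
exact: (@measurable_fun_integral_finite_kernel _ _ _ _ _ f kh).
Qed.

End kernel_integral.

(* Gives access to the probability structure of the fibers [mu x] of a kernel,
   which canonical structures only see as measures. *)
Section probability_of_measure.
Context d (T : measurableType d) (R : realType).
Variables (m : {measure set T -> \bar R}) (m1 : m setT = 1%E).

Let m' : set T -> \bar R := m.

#[local] HB.instance Definition _ := Measure.on m'.
#[local] HB.instance Definition _ := Measure_isProbability.Build d T R m' m1.

Lemma measure_probability : exists P : probability T R, P = m :> (set T -> \bar R).
Proof. by exists m'. Qed.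

End probability_of_measure.

(** * Measurability in the prompt of integrals over responses *)

Section inner_integrals.
Context {dX dY : measure_display} {X : measurableType dX}
  {Y : measurableType dY} {R : realType}.
Variable mu : R.-pker X ~> Y.

Lemma pkerP x : exists P : probability Y R, P = mu x :> (set Y -> \bar R).
Proof. by apply: measure_probability; exact: prob_kernel. Qed.

(** By Tonelli this is an iterated integral against [mu]. Integrating one response at a time keeps
    measurability in the remaining variables, first in [(x, y)] and then in [x]. *)
Lemma ge0_measurable_int2 (f : X * (Y * Y) -> \bar R) :
  (forall w, 0 <= f w)%E -> measurable_fun setT f ->
  measurable_fun setT (fun x => \int[mu x \x mu x]_z f (x, z))%E.
Proof.
move=> f0 mf.
pose g (w : X * Y * Y) := f (w.1.1, (w.1.2, w.2)).
have mg : measurable_fun setT g.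
  apply: (measurableT_comp mf); apply: measurable_fun_pair => /=.
    exact: measurableT_comp.
  by apply: measurable_fun_pair => //; exact: measurableT_comp.
pose G (w : X * Y) := (\int[mu w.1]_y g (w, y))%E.
have mG : measurable_fun setT G.
  by apply: (@measurable_fun_integral_kernel_comp _ _ _ _ _ _ _ mu fst _ g) => // z; exact: f0.
have G0 w : (0 <= G w)%E by apply: integral_ge0 => y _; exact: f0.
rewrite (_ : (fun x => _) = (fun x => \int[mu x]_y G (x, y))%E).
  exact: (@measurable_fun_integral_kernel_comp _ _ _ _ _ _ _ mu id _ G).
apply/funext => x; have [P Px] := pkerP x.
rewrite /G /g /= -Px.
apply: (@fubini_tonelli1 _ _ _ _ _ P P (fun z => f (x, z))) => [|z]; last exact: f0.
exact: measurableT_comp mf (pair1_measurable x).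
Qed.

Lemma ge0_measurable_int3 (f : X * (Y * Y * Y) -> \bar R) :
  (forall w, 0 <= f w)%E -> measurable_fun setT f ->
  measurable_fun setT (fun x => \int[(mu x \x mu x) \x mu x]_z f (x, z))%E.
Proof.
move=> f0 mf.
pose g (w : X * (Y * Y) * Y) := f (w.1.1, (w.1.2, w.2)).
have mg : measurable_fun setT g.
  apply: (measurableT_comp mf); apply: measurable_fun_pair => /=.
    exact: measurableT_comp.
  by apply: measurable_fun_pair => //; exact: measurableT_comp.
pose G (w : X * (Y * Y)) := (\int[mu w.1]_y g (w, y))%E.
have mG : measurable_fun setT G.
  by apply: (@measurable_fun_integral_kernel_comp _ _ _ _ _ _ _ mu fst _ g) => // z; exact: f0.
have G0 w : (0 <= G w)%E by apply: integral_ge0 => y _; exact: f0.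
rewrite (_ : (fun x => _) = (fun x => \int[mu x \x mu x]_z G (x, z))%E).
  exact: ge0_measurable_int2.
apply/funext => x; have [P Px] := pkerP x.
rewrite /G /g /= -Px.
pose PP : probability (Y * Y)%type R := (P \x P)%E.
apply: (@fubini_tonelli1 _ _ _ _ _ PP P (fun z => f (x, z))) => [|z]; last exact: f0.
exact: measurableT_comp mf (pair1_measurable x).
Qed.

Lemma measurable_int2 (f : X * (Y * Y) -> \bar R) :
  measurable_fun setT f ->
  measurable_fun setT (fun x => \int[mu x \x mu x]_z f (x, z))%E.
Proof.
move=> mf.
have mfp : measurable_fun setT f^\+%E by exact: measurable_funepos.
have mfn : measurable_fun setT f^\-%E by exact: measurable_funeneg.
have := emeasurable_funB
  (ge0_measurable_int2 (fun w => funepos_ge0 f w) mfp)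
  (ge0_measurable_int2 (fun w => funeneg_ge0 f w) mfn).
rewrite (_ : (fun x => _) = (fun x => \int[mu x \x mu x]_z f (x, z))%E)//.
apply/funext => x; have [P Px] := pkerP x; rewrite -Px; apply/esym.
rewrite (integralE (P \x P)%E setT (fun z => f (x, z))).
by congr (_ - _)%E; apply: eq_integral => z _; rewrite ?funeposE ?funenegE.
Qed.

(** The sign condition is removed by splitting into positive and negative parts, because
    [kappa_min q] may be negative as long as [q] is not truncated. *)
Lemma measurable_int3 (f : X * (Y * Y * Y) -> \bar R) :
  measurable_fun setT f ->
  measurable_fun setT (fun x => \int[(mu x \x mu x) \x mu x]_z f (x, z))%E.
Proof.
move=> mf.
have mfp : measurable_fun setT f^\+%E by exact: measurable_funepos.
have mfn : measurable_fun setT f^\-%E by exact: measurable_funeneg.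
have := emeasurable_funB
  (ge0_measurable_int3 (fun w => funepos_ge0 f w) mfp)
  (ge0_measurable_int3 (fun w => funeneg_ge0 f w) mfn).
rewrite (_ : (fun x => _) = (fun x => \int[(mu x \x mu x) \x mu x]_z f (x, z))%E)//.
apply/funext => x; have [P Px] := pkerP x; rewrite -Px; apply/esym.
pose PP : probability (Y * Y)%type R := (P \x P)%E.
rewrite (integralE (PP \x P)%E setT (fun z => f (x, z))).
by congr (_ - _)%E; apply: eq_integral => z _; rewrite ?funeposE ?funenegE.
Qed.

End inner_integrals.

(** * Measurability and pointwise bounds of the integrands *)

Section preference_measurability.
Context {dX dY : measure_display} {X : measurableType dX}
  {Y : measurableType dY} {R : realType}.
Implicit Types q r : X * (Y * Y) -> R.

Lemma measurable_pair12 : measurable_fun setT (@pair12 _ _ X Y).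
Proof.
apply: measurable_fun_pair => //; apply: measurable_fun_pair;
  by do 2?apply: measurableT_comp => //.
Qed.

Lemma measurable_pair23 : measurable_fun setT (@pair23 _ _ X Y).
Proof.
apply: measurable_fun_pair => //; apply: measurable_fun_pair;
  by do 2?apply: measurableT_comp => //.
Qed.

Lemma measurable_pair31 : measurable_fun setT (@pair31 _ _ X Y).
Proof.
apply: measurable_fun_pair => //; apply: measurable_fun_pair;
  by do 2?apply: measurableT_comp => //.
Qed.

Lemma measurable_kappa q :
  measurable_fun setT q -> measurable_fun setT (kappa q).
Proof.
move=> mq; have m_eta : measurable_fun setT (Defs.eta q).
  by rewrite /Defs.eta; apply: measurable_minr => //; exact: measurable_funB.
by rewrite /kappa; apply: measurable_funM => //; exact: measurable_funB.
Qed.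

Lemma measurable_kappa_min q :
  measurable_fun setT q -> measurable_fun setT (kappa_min q).
Proof.
move=> /measurable_kappa mk; rewrite /kappa_min; apply: measurable_minr.
  exact: measurableT_comp mk measurable_pair12.
apply: measurable_minr.
  exact: measurableT_comp mk measurable_pair23.
exact: measurableT_comp mk measurable_pair31.
Qed.

Lemma measurable_CC gamma q :
  measurable_fun setT q -> measurable (CC gamma q).
Proof.
move=> mq.
have H (B : set R) (h : X * (Y * Y * Y) -> X * (Y * Y)) :
    measurable_fun setT h -> measurable B -> measurable ((q \o h) @^-1` B).
  by move=> mh mB; rewrite -[X in measurable X]setTI; exact: (measurableT_comp mq mh).
have -> : CC gamma q =
    ((q \o @pair12 _ _ X Y) @^-1` `[2^-1 + gamma, +oo[ `&`
     ((q \o @pair23 _ _ X Y) @^-1` `[2^-1 + gamma, +oo[ `&`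
      (q \o @pair31 _ _ X Y) @^-1` `[2^-1 + gamma, +oo[)) `|`
    ((q \o @pair12 _ _ X Y) @^-1` `]-oo, 2^-1 - gamma] `&`
     ((q \o @pair23 _ _ X Y) @^-1` `]-oo, 2^-1 - gamma] `&`
      (q \o @pair31 _ _ X Y) @^-1` `]-oo, 2^-1 - gamma])).
  apply/seteqP; split => t; rewrite /CC /= !in_itv/= !andbT.
    by case=> -[? ? ?]; [left|right].
  by case=> -[? [? ?]]; [left|right].
by apply: measurableU; do 2?apply: measurableI;
  apply: H (measurable_itv _);
  [exact: measurable_pair12|exact: measurable_pair23|exact: measurable_pair31|
   exact: measurable_pair12|exact: measurable_pair23|exact: measurable_pair31].
Qed.

Lemma measurable_cyc gamma q r :
  measurable_fun setT q -> measurable_fun setT r ->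
  measurable_fun setT (fun t => (kappa_min q t * \1_(CC gamma r) t)%:E).
Proof.
move=> mq mr; apply/measurable_EFinP; apply: measurable_funM.
  exact: measurable_kappa_min.
by apply: measurable_indic; exact: measurable_CC.
Qed.

Lemma measurable_sqB q r :
  measurable_fun setT q -> measurable_fun setT r ->
  measurable_fun setT (fun w => ((q w - r w) ^+ 2)%:E).
Proof.
by move=> mq mr; apply/measurable_EFinP; apply: measurable_funX; exact: measurable_funB.
Qed.

Lemma kappa_itv q w : 0 <= q w <= 1 -> 0 <= kappa q w <= 1.
Proof.
move=> /andP[q0 q1]; have : 0 <= Defs.eta q w <= 1.
  by rewrite /Defs.eta le_min q0 subr_ge0 q1/= ge_min q1.
rewrite /kappa; move: (Defs.eta q w) => e /andP[e0 e1].
by rewrite mulr_ge0 ?subr_ge0//= mulr_ile1// ?subr_ge0// gerBl.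
Qed.

Lemma kappa_min_itv q t : (forall w, 0 <= q w <= 1) -> 0 <= kappa_min q t <= 1.
Proof.
move=> q01; have k01 w := kappa_itv (q01 w).
have /andP[a0 a1] := k01 (pair12 t); have /andP[b0 b1] := k01 (pair23 t).
have /andP[c0 c1] := k01 (pair31 t).
by rewrite /kappa_min !le_min a0 b0 c0/= ge_min a1.
Qed.

(** Off [CC (2 * delta) p] the left side is zero, and on [CC delta q] the first term on the right
    suffices. Otherwise some pair has [p] and [q] at least [delta] apart, the distance between the
    two thresholds, and its square alone makes the error term at least 1, which bounds
    [kappa_min]. *)
Lemma cyc_kappa_pointwise p q (delta : R) t :
  (forall w, 0 <= q w <= 1) -> 0 < delta ->
  kappa_min q t * \1_(CC (2 * delta) p) t <=
  kappa_min q t * \1_(CC delta q) t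
  + (delta ^+ 2)^-1 * ((p (pair12 t) - q (pair12 t)) ^+ 2
    + (p (pair23 t) - q (pair23 t)) ^+ 2
    + (p (pair31 t) - q (pair31 t)) ^+ 2).
Proof.
move=> q01 d0; have /andP[k0 k1] := kappa_min_itv t q01.
have d2 : 0 < delta ^+ 2 by rewrite exprn_gt0.
set a := p (pair12 t); set b := p (pair23 t); set c := p (pair31 t).
set a' := q (pair12 t); set b' := q (pair23 t); set c' := q (pair31 t).
have S0 : 0 <= (delta ^+ 2)^-1 * ((a - a') ^+ 2 + (b - b') ^+ 2 + (c - c') ^+ 2).
  apply: mulr_ge0; first by rewrite invr_ge0 ltW.
  by rewrite !addr_ge0 ?sqr_ge0.
rewrite !indicE; have [pC|_] := boolP (t \in CC (2 * delta) p); last first.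
  by rewrite mulr0; apply: addr_ge0 => //; apply: mulr_ge0 => //; exact: ler0n.
have [qC|qC] := boolP (t \in CC delta q).
  by rewrite lerDl.
(* Bounding [kappa_min] by 1 leaves [delta ^+ 2] to be compared with the sum of the three
   squares. *)
rewrite mulr1 mulr0 add0r (le_trans k1)// mulrC ler_pdivlMr// mul1r.
have far (x y : R) : (delta < x - y) || (delta < y - x) -> delta ^+ 2 <= (x - y) ^+ 2.
  by move=> /orP[]; nra.
suff [h|h|h] : [\/ delta ^+ 2 <= (a - a') ^+ 2, delta ^+ 2 <= (b - b') ^+ 2
    | delta ^+ 2 <= (c - c') ^+ 2].
- by have := sqr_ge0 (b - b'); have := sqr_ge0 (c - c'); move: h; lra.
- by have := sqr_ge0 (a - a'); have := sqr_ge0 (c - c'); move: h; lra.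
- by have := sqr_ge0 (a - a'); have := sqr_ge0 (b - b'); move: h; lra.
move: pC; rewrite inE /CC /= -/a -/b -/c => -[[pa pb pc]|[pa pb pc]].
(* The first pair at which [q] misses its threshold is the distant one; if none did, [t] would lie
   in [CC delta q]. *)
- have [?|ha] := ltP a' (2^-1 + delta).
    by apply: Or31; apply: far; apply/orP; left; lra.
  have [?|hb] := ltP b' (2^-1 + delta).
    by apply: Or32; apply: far; apply/orP; left; lra.
  have [?|hc] := ltP c' (2^-1 + delta).
    by apply: Or33; apply: far; apply/orP; left; lra.
  by exfalso; move/negP: qC; apply; rewrite inE; left.
- have [?|ha] := ltP (2^-1 - delta) a'.
    by apply: Or31; apply: far; apply/orP; right; lra.
  have [?|hb] := ltP (2^-1 - delta) b'.
    by apply: Or32; apply: far; apply/orP; right; lra.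
  have [?|hc] := ltP (2^-1 - delta) c'.
    by apply: Or33; apply: far; apply/orP; right; lra.
  by exfalso; move/negP: qC; apply; rewrite inE; right.
Qed.

End preference_measurability.

(** * The mean preference *)

Section mean_pref.
Context {dX dY : measure_display} {X : measurableType dX}
  {Y : measurableType dY} {R : realType}.

Lemma logistic_itv (t : R) : 0 <= logistic t <= 1.
Proof.
have e0 := expR_gt0 (- t); rewrite /logistic; apply/andP; split.
  by rewrite invr_ge0; apply: addr_ge0 => //; exact: ltW.
by rewrite invf_le1 ?addr_gt0// lerDl ltW.
Qed.

Lemma logisticN (t : R) : logistic t + logistic (- t) = 1.
Proof.
rewrite /logistic opprK expRN.
have e0 := expR_gt0 t; have e1 : 1 + expR t != 0 by rewrite gt_eqF// addr_gt0.
by field; rewrite e1 gt_eqF.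
Qed.

Lemma measurable_logistic : measurable_fun setT (@logistic R).
Proof.
apply: continuous_measurable_fun => t; rewrite /logistic.
apply: (@cvgV _ _ _ _ (fun s : R => 1 + expR (- s))).
  by rewrite gt_eqF// addr_gt0// expR_gt0.
apply: cvgD; first exact: cvg_cst.
by apply: continuous_comp; [exact: opp_continuous|exact: continuous_expR].
Qed.

Variables (n : nat) (n_gt0 : (0 < n)%N) (u : 'I_n -> X * Y -> R).

Lemma mean_pref_itv w : 0 <= mean_pref u w <= 1.
Proof.
have n0 : 0 < n%:R :> R by rewrite ltr0n.
rewrite /mean_pref mulr_ge0 ?invr_ge0 ?ler0n//=; last first.
  by apply: sumr_ge0 => i _; case/andP: (logistic_itv (u i (w.1, w.2.1) - u i (w.1, w.2.2))).
rewrite mulrC ler_pdivrMr// mul1r -[X in X%:R]card_ord -sum1_card natr_sum.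
by apply: ler_sum => i _; case/andP: (logistic_itv (u i (w.1, w.2.1) - u i (w.1, w.2.2))).
Qed.

(** Swapping the responses negates every utility difference, so the logistic terms add up to 1
    annotator by annotator. This fixes the value [2^-1] in the case of a constant embedding. *)
Lemma mean_pref_swap x y y' :
  mean_pref u (x, (y, y')) + mean_pref u (x, (y', y)) = 1.
Proof.
rewrite /mean_pref -mulrDr -big_split/=.
under eq_bigr do rewrite -[X in _ + logistic X]opprB logisticN.
by rewrite sumr_const card_ord mulVf// pnatr_eq0 -lt0n.
Qed.

Lemma measurable_mean_pref : (forall i, measurable_fun setT (u i)) ->
  measurable_fun setT (mean_pref u).
Proof.
move=> mu_u; apply: measurable_funM => //; apply: measurable_sum => i.
apply: (measurableT_comp measurable_logistic); apply: measurable_funB.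
  apply: (measurableT_comp (mu_u i)); apply: measurable_fun_pair => //.
  exact: measurableT_comp.
apply: (measurableT_comp (mu_u i)); apply: measurable_fun_pair => //.
exact: measurableT_comp.
Qed.
End mean_pref.

(** * Independence of the integrals from the chosen version *)

Section fiberwise_ae.
Context {dX dY : measure_display} {X : measurableType dX}
  {Y : measurableType dY} {R : realType}.
Variables (nu : probability X R) (mu : R.-pker X ~> Y).

Lemma measurable_mse_fiber (p q : X * (Y * Y) -> R) :
  measurable_fun setT p -> measurable_fun setT q ->
  measurable_fun setT
    (fun x => \int[mu x \x mu x]_z ((p (x, z) - q (x, z)) ^+ 2)%:E)%E.
Proof. by move=> mp mq; exact: (measurable_int2 mu (measurable_sqB mp mq)). Qed.

Lemma measurable_cyc_kappa_fiber gamma (q r : X * (Y * Y) -> R) :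
  measurable_fun setT q -> measurable_fun setT r ->
  measurable_fun setT (fun x => \int[(mu x \x mu x) \x mu x]_z
    (kappa_min q (x, z) * \1_(CC gamma r) (x, z))%:E)%E.
Proof.
by move=> mq mr; exact: (measurable_int3 mu (measurable_cyc gamma mq mr)).
Qed.

(** The nested quantifiers match [is_emb_pref], which determines a version only at almost every
    prompt, and there only up to a null set of pairs. *)
Definition fiberwise_ae_eq (q r : X * (Y * Y) -> R) : Prop :=
  {ae nu, forall x, {ae (mu x \x mu x)%E, forall z, q (x, z) = r (x, z)}}.

(** Each of the three pairs has law [P \x P], so the exceptional triples form a union of three null
    sets. *)
Lemma ae_marginals (P : probability Y R) (Q : Y * Y -> Prop) :
  {ae (P \x P)%E, forall z, Q z} ->
  {ae (P \x P \x P)%E, forall t : Y * Y * Y,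
    [/\ Q (t.1.1, t.1.2), Q (t.1.2, t.2) & Q (t.2, t.1.1)]}.
Proof.
move=> aeQ.
pose PP : probability (Y * Y)%type R := (P \x P)%E.
pose PPP : probability (Y * Y * Y)%type R := (PP \x P)%E.
have m12 : measurable_fun setT (fun t : Y * Y * Y => (t.1.1, t.1.2)).
  by apply: measurable_fun_pair; exact: measurableT_comp.
have m23 : measurable_fun setT (fun t : Y * Y * Y => (t.1.2, t.2)).
  by apply: measurable_fun_pair => //; exact: measurableT_comp.
have m31 : measurable_fun setT (fun t : Y * Y * Y => (t.2, t.1.1)).
  by apply: measurable_fun_pair => //; exact: measurableT_comp.
have a12 := ae_comp_of_integral (m := PPP) (m' := PP) m12 (ge0_integral_marg12 P) aeQ.
have a23 := ae_comp_of_integral (m := PPP) (m' := PP) m23 (ge0_integral_marg23 P) aeQ.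
have a31 := ae_comp_of_integral (m := PPP) (m' := PP) m31 (ge0_integral_marg31 P) aeQ.
have := negligibleU a12 (negligibleU a23 a31); apply: negligibleS => t /= H.
have [?|?] := pselect (Q (t.1.1, t.1.2)); last by left.
have [?|?] := pselect (Q (t.1.2, t.2)); last by right; left.
have [?|?] := pselect (Q (t.2, t.1.1)); last by right; right.
by exfalso; apply: H; split.
Qed.

Lemma mse_ae_eq p q r : measurable_fun setT p -> measurable_fun setT q ->
  measurable_fun setT r -> fiberwise_ae_eq q r -> mse nu mu p q = mse nu mu p r.
Proof.
move=> mp mq mr qr; apply: ae_eq_integral => //.
- exact: measurable_mse_fiber.
- exact: measurable_mse_fiber.
apply: negligibleS qr => x /=; apply: contra_not => H _.
have [P Px] := pkerP mu x; move: H; rewrite -Px => H.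
apply: (ae_eq_integral (mu := (P \x P)%E)) => //.
- exact: measurableT_comp (measurable_sqB mp mq) (pair1_measurable x).
- exact: measurableT_comp (measurable_sqB mp mr) (pair1_measurable x).
by apply: negligibleS H => z /=; apply: contra_not => -> _.
Qed.

(** The integrand at a triple depends on [q] and [r] only through their values at its three pairs,
    so [ae_marginals] applies on almost every fiber. *)
Lemma cyc_kappa_ae_eq gamma q r q' r' :
  measurable_fun setT q -> measurable_fun setT r ->
  measurable_fun setT q' -> measurable_fun setT r' ->
  fiberwise_ae_eq q q' -> fiberwise_ae_eq r r' ->
  cyc_kappa nu mu gamma q r = cyc_kappa nu mu gamma q' r'.
Proof.
move=> mq mr mq' mr' qq rr; apply: ae_eq_integral => //.
- exact: measurable_cyc_kappa_fiber.
- exact: measurable_cyc_kappa_fiber.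
have := negligibleU qq rr; apply: negligibleS => x /= H.
apply/not_andP; apply: contra_not H => -[H1 H2] _.
have [P Px] := pkerP mu x; move: H1 H2; rewrite -Px => H1 H2.
pose PP : probability (Y * Y)%type R := (P \x P)%E.
apply: (ae_eq_integral (mu := (PP \x P)%E)) => //.
- exact: measurableT_comp (measurable_cyc gamma mq mr) (pair1_measurable x).
- exact: measurableT_comp (measurable_cyc gamma mq' mr') (pair1_measurable x).
have := negligibleU (ae_marginals H1) (ae_marginals H2).
apply: negligibleS => t /= H; apply/not_andP; apply: contra_not H.
move=> -[[a b c] [a' b' c']] _; congr EFin; congr (_ * _).
  by rewrite /kappa_min /kappa /Defs.eta /pair12 /pair23 /pair31 /= a b c.
rewrite !indicE; congr (nat_of_bool _)%:R; apply: asbool_equiv_eq.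
by rewrite /CC /pair12 /pair23 /pair31 /= a' b' c'.
Qed.

End fiberwise_ae.

(** * Error monotonicity, the lower bound and the constant embedding *)

Section embedded_preferences.
Context {dX dY : measure_display} {X : measurableType dX}
  {Y : measurableType dY} {R : realType}.
Variables (nu : probability X R) (mu : R.-pker X ~> Y).

Lemma ge0_int2 x (f : Y * Y -> \bar R) :
  (forall z, 0 <= f z)%E -> (0 <= \int[mu x \x mu x]_z f z)%E.
Proof.
move=> f0; have [P Px] := pkerP mu x; rewrite -Px.
by apply: (@integral_ge0 _ _ _ (P \x P)%E).
Qed.

Lemma ge0_int3 x (f : Y * Y * Y -> \bar R) :
  (forall z, 0 <= f z)%E -> (0 <= \int[(mu x \x mu x) \x mu x]_z f z)%E.
Proof.
move=> f0; have [P Px] := pkerP mu x; rewrite -Px.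
pose PP : probability (Y * Y)%type R := (P \x P)%E.
by apply: (@integral_ge0 _ _ _ (PP \x P)%E).
Qed.

Let fiber_sigma {dV : measure_display} {V : measurableType dV}
    (f : X * Y -> V) (x : X) : set (set (Y * Y)) :=
  g_sigma_algebra_preimage (fun z : Y * Y => pair_emb f (x, z)).

Lemma fiber_sigma_measurable (dV : measure_display) (V : measurableType dV)
    (f : X * Y -> V) (x : X) :
  measurable_fun setT f -> fiber_sigma f x `<=` measurable.
Proof.
move=> mf A [B mB <-].
have mF : measurable_fun setT (fun z : Y * Y => pair_emb f (x, z)).
  rewrite /pair_emb /=; apply: measurable_fun_pair.
    by apply: (measurableT_comp mf); exact: measurable_fun_pair.
  by apply: (measurableT_comp mf); exact: measurable_fun_pair.
exact: mF.
Qed.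

(** The fiber sigma-field consists of the sections at [x] of the sets in the global one, so an
    inclusion of sigma-fields on [X * (Y * Y)] passes to every prompt. *)
Lemma fiber_sigma_subset (dV dV' : measure_display) (V : measurableType dV)
    (V' : measurableType dV') (f : X * Y -> V) (f' : X * Y -> V') (x : X) :
  g_sigma_algebra_preimage (pair_emb f) `<=`
    g_sigma_algebra_preimage (pair_emb f') ->
  fiber_sigma f x `<=` fiber_sigma f' x.
Proof.
move=> ff' A [B mB <-].
have [|B' mB' BB'] := ff' (pair_emb f @^-1` B).
  by exists B => //; rewrite setTI.
exists B' => //; rewrite !setTI; apply/seteqP; split => z /= Bz.
  by have : (pair_emb f @^-1` B) (x, z) by rewrite -BB'.
have : (pair_emb f @^-1` B) (x, z) by [].
by rewrite -BB' => -[].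
Qed.

Variable p : X * (Y * Y) -> R.
Hypotheses (mp : measurable_fun setT p) (p01 : forall w, 0 <= p w <= 1).

Let mpx x : measurable_fun setT (fun z => p (x, z)).
Proof. exact: measurableT_comp mp (pair1_measurable x). Qed.

Lemma emb_pref_clamp01 (dV : measure_display) (V : measurableType dV)
    (f : X * Y -> V) (q : X * (Y * Y) -> R) :
  measurable_fun setT f -> is_emb_pref nu mu f p q ->
  is_emb_pref nu mu f p (clamp01 \o q) /\ fiberwise_ae_eq nu mu q (clamp01 \o q).
Proof.
move=> mf [mq aeq]; split; first split.
- by apply: measurableT_comp mq; exact: measurable_clamp01.
- apply: negligibleS aeq => x /=; apply: contra_not.
  have [P Px] := pkerP mu x; rewrite -Px => H.
  exact: (is_cond_exp_clamp01 (P := (P \x P)%E) (fiber_sigma_measurable mf) (mpx x) _ H).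
- apply: negligibleS aeq => x /=; apply: contra_not.
  have [P Px] := pkerP mu x; rewrite -Px => H.
  have := cond_exp_clamp01_ae (P := (P \x P)%E) (fiber_sigma_measurable mf)
    (mpx x) (fun z => p01 _) H.
  by apply: negligibleS => z /=; apply: contra_not; exact.
Qed.

(** On almost every fiber [q] is measurable for the finer sigma-field of [f'], hence it competes
    with the projection [q'] of [p]. *)
Lemma mse_emb_pref_mono (dV dV' : measure_display) (V : measurableType dV)
    (V' : measurableType dV') (f : X * Y -> V) (f' : X * Y -> V')
    (q q' : X * (Y * Y) -> R) :
  measurable_fun setT f' ->
  g_sigma_algebra_preimage (pair_emb f) `<=`
    g_sigma_algebra_preimage (pair_emb f') ->
  is_emb_pref nu mu f p q -> is_emb_pref nu mu f' p q' ->
  (forall w, 0 <= q w <= 1) -> (forall w, 0 <= q' w <= 1) ->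
  (mse nu mu p q' <= mse nu mu p q)%E.
Proof.
move=> mf' ff' [mq aeq] [mq' aeq'] q01 q'01.
apply: ae_ge0_le_integral => //.
- by move=> x _; apply: ge0_int2 => z; rewrite lee_fin sqr_ge0.
- exact: (measurable_mse_fiber mu mp mq').
- by move=> x _; apply: ge0_int2 => z; rewrite lee_fin sqr_ge0.
- exact: (measurable_mse_fiber mu mp mq).
have := negligibleU aeq aeq'; apply: negligibleS => x /= H.
apply/not_andP; apply: contra_not H => -[H H'] _.
have [P Px] := pkerP mu x; move: H H'; rewrite -Px => H H'.
apply: (cond_exp_l2_proj (P := (P \x P)%E) (fiber_sigma_measurable (x := x) mf') (mpx x)
  (fun z => p01 _) (fun z => q'01 _) H' _ (fun z => q01 _)).
by case: H => H _ _ B mB; apply: (fiber_sigma_subset ff'); exact: H.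
Qed.

(** The pointwise bound is integrated; each of its three squares contributes one copy of the mean
    square error. *)
Lemma cyc_kappa_le_mse (q : X * (Y * Y) -> R) (delta : R) :
  measurable_fun setT q -> (forall w, 0 <= q w <= 1) -> 0 < delta ->
  (cyc_kappa nu mu (2 * delta) q p <=
   cyc_kappa nu mu delta q q + (3 / delta ^+ 2)%:E * mse nu mu p q)%E.
Proof.
move=> mq q01 d0.
have id2 : 0 <= (delta ^+ 2)^-1 by rewrite invr_ge0 sqr_ge0.
have c0 : 0 <= 3 / delta ^+ 2 by rewrite mulr_ge0.
have k0 gamma r t : (0 <= (kappa_min q t * \1_(CC gamma r) t)%:E)%E.
  by rewrite lee_fin mulr_ge0//; case/andP: (kappa_min_itv t q01).
have m3 gamma (r : X * (Y * Y) -> R) : measurable_fun setT r -> measurable_fun setT (fun x =>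
    \int[(mu x \x mu x) \x mu x]_z (kappa_min q (x, z) * \1_(CC gamma r) (x, z))%:E)%E.
  by move=> mr; exact: (measurable_cyc_kappa_fiber mu gamma mq mr).
have m2 : measurable_fun setT (fun x =>
    \int[mu x \x mu x]_z ((p (x, z) - q (x, z)) ^+ 2)%:E)%E.
  exact: measurable_mse_fiber.
have i2 x : (0 <= \int[mu x \x mu x]_z ((p (x, z) - q (x, z)) ^+ 2)%:E)%E.
  by apply: ge0_int2 => z; rewrite lee_fin sqr_ge0.
have i3 gamma r x : (0 <= \int[(mu x \x mu x) \x mu x]_z
    (kappa_min q (x, z) * \1_(CC gamma r) (x, z))%:E)%E.
  by apply: ge0_int3 => z; exact: k0.
rewrite /cyc_kappa /mse -ge0_integralZl_EFin// -ge0_integralD//; last 3 first.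
- exact: m3.
- by move=> x _; rewrite mule_ge0.
- exact: measurable_funeM.
apply: ge0_le_integral => //.
- exact: m3.
- by apply: emeasurable_funD; [exact: m3|exact: measurable_funeM].
move=> x _; have [P Px] := pkerP mu x; rewrite -Px.
pose PP : probability (Y * Y)%type R := (P \x P)%E.
pose PPP : probability (Y * Y * Y)%type R := (PP \x P)%E.
pose s (z : Y * Y) := ((p (x, z) - q (x, z)) ^+ 2)%:E.
have ms : measurable_fun setT s.
  exact: measurableT_comp (measurable_sqB mp mq) (pair1_measurable x).
have s0 z : (0 <= s z)%E by rewrite lee_fin sqr_ge0.
have m12 : measurable_fun setT (fun t : Y * Y * Y => s (t.1.1, t.1.2)).
  by apply: (measurableT_comp ms); apply: measurable_fun_pair; exact: measurableT_comp.
have m23 : measurable_fun setT (fun t : Y * Y * Y => s (t.1.2, t.2)).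
  by apply: (measurableT_comp ms); apply: measurable_fun_pair => //; exact: measurableT_comp.
have m31 : measurable_fun setT (fun t : Y * Y * Y => s (t.2, t.1.1)).
  by apply: (measurableT_comp ms); apply: measurable_fun_pair => //; exact: measurableT_comp.
have mk gamma (r : X * (Y * Y) -> R) : measurable_fun setT r -> measurable_fun setT
    (fun t => (kappa_min q (x, t) * \1_(CC gamma r) (x, t))%:E).
  by move=> mr; exact: measurableT_comp (measurable_cyc gamma mq mr) (pair1_measurable x).
(* The error over pairs is rewritten as an integral over triples, so that both sides can be compared
   under a single integral. *)
have -> : ((3 / delta ^+ 2)%:E * \int[P \x P]_z s z =
    \int[PPP]_t ((delta ^+ 2)^-1%:E *
      (s (t.1.1, t.1.2) + s (t.1.2, t.2) + s (t.2, t.1.1))))%E.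
  rewrite ge0_integralZl_EFin//; last 2 first.
  - by move=> t _; rewrite !adde_ge0.
  - by apply: emeasurable_funD => //; exact: emeasurable_funD.
  rewrite ge0_integralD//; last 2 first.
  - by move=> t _; rewrite adde_ge0.
  - exact: emeasurable_funD.
  rewrite ge0_integralD//.
  rewrite [X in (X + _ + _)%E](ge0_integral_marg12 P ms s0).
  rewrite [X in (_ + X + _)%E](ge0_integral_marg23 P ms s0).
  rewrite [X in (_ + _ + X)%E](ge0_integral_marg31 P ms s0).
  have -> (S : \bar R) : (S + S + S = 3%:E * S)%E by rewrite (mule_natl _ 3) -addeA.
  by rewrite muleA -EFinM mulrC.
have mS : measurable_fun setT (fun t : Y * Y * Y =>
    ((delta ^+ 2)^-1%:E * (s (t.1.1, t.1.2) + s (t.1.2, t.2) + s (t.2, t.1.1)))%E).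
  apply: measurable_funeM.
  by apply: emeasurable_funD => //; exact: emeasurable_funD.
have S0 (t : Y * Y * Y) : (0 <= (delta ^+ 2)^-1%:E *
    (s (t.1.1, t.1.2) + s (t.1.2, t.2) + s (t.2, t.1.1)))%E.
  by rewrite mule_ge0 ?adde_ge0.
rewrite -(ge0_integralD PPP measurableT) //; last exact: mk.
apply: (@ge0_le_integral _ _ _ PPP) => //.
- exact: mk.
- by apply: emeasurable_funD => //; exact: mk.
by move=> t _; have := cyc_kappa_pointwise p (x, t) q01 d0; rewrite -lee_fin; exact.
Qed.

Hypothesis p_swap : forall x y y', p (x, (y, y')) + p (x, (y', y)) = 1.

(** A constant map generates the trivial sigma-field, so on a good fiber [q] is constant everywhere,
    equal to the mean of [p]. By the swap symmetry twice this mean is 1. *)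
Lemma emb_pref_const (dV : measure_display) (V : measurableType dV)
    (f : X * Y -> V) (q : X * (Y * Y) -> R) :
  (forall w w', f w = f w') -> is_emb_pref nu mu f p q ->
  {ae nu, forall x, forall z, q (x, z) = 2^-1}.
Proof.
move=> fc [mq aeq]; apply: negligibleS aeq => x /=; apply: contra_not.
have [P Px] := pkerP mu x; rewrite -Px => -[Gq iq qp] z.
(* The level set of [q] through [z] is a preimage under a constant map, so it contains every
   [z']. *)
have qc z' : q (x, z') = q (x, z).
  have [B _] := Gq [set q (x, z)] (measurable_set1 _).
  rewrite setTI => Bq.
  have : [set q (x, z)] (q (x, z)) by [].
  rewrite -[_ (q (x, z))]/(((fun z => q (x, z)) @^-1` [set q (x, z)]) z) -Bq /=.
  rewrite (_ : pair_emb f (x, z) = pair_emb f (x, z')); last first.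
    by congr pair; exact: fc.
  by rewrite -[B _]/(((fun z => pair_emb f (x, z)) @^-1` B) z') Bq.
pose PP : probability (Y * Y)%type R := (P \x P)%E.
have qI : (q (x, z))%:E = (\int[P \x P]_z (p (x, z))%:E)%E.
  rewrite -(qp setT (ex_intro2 _ _ setT measurableT (setTI _))).
  rewrite -[LHS](integral_prob_cst PP); apply: eq_integral => z' _.
  by rewrite qc.
have pz0 z' : (0 <= (p (x, z'))%:E)%E by rewrite lee_fin; case/andP: (p01 (x, z')).
have mpE : measurable_fun setT (fun z => (p (x, z))%:E) by apply/measurable_EFinP.
(* The constant 1 is integrated as [p] plus its swap. *)
have := integral_prob_cst PP 1.
rewrite (eq_integral (fun z => (p (x, z))%:E + (p (x, (z.2, z.1)))%:E)%E); last first.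
  by move=> [y y'] _; rewrite -EFinD p_swap.
have msw : measurable_fun setT (fun z : Y * Y => (p (x, (z.2, z.1)))%:E).
  by apply: (measurableT_comp mpE); exact: measurable_fun_pair.
rewrite ge0_integralD//.
rewrite [X in (_ + X)%E](ge0_integral_swap P mpE pz0) -qI -EFinD => -[].
lra.
Qed.

Lemma cyc_kappa_const (dV : measure_display) (V : measurableType dV)
    (f : X * Y -> V) (q : X * (Y * Y) -> R) (delta : R) :
  (forall w w', f w = f w') -> is_emb_pref nu mu f p q -> 0 < delta ->
  cyc_kappa nu mu delta q q = 0%E.
Proof.
move=> fc qP d0; rewrite /cyc_kappa -[RHS](integral0 nu setT).
have mq : measurable_fun setT q by case: qP.
apply: ae_eq_integral => //.
  exact: measurable_cyc_kappa_fiber.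
apply: negligibleS (emb_pref_const fc qP) => x /=; apply: contra_not => qx _.
have [P Px] := pkerP mu x; rewrite -Px.
apply: integral0_eq => t _; rewrite indicE memNset ?mulr0//.
(* The value [2^-1] meets neither threshold, since [delta] is positive. *)
by rewrite /CC /= !qx => -[[]|[]]; lra.
Qed.

End embedded_preferences.

(** * Assembly of the three claims *)

Lemma leeBl_addr (R : realDomainType) (x y e : \bar R) :
  (0 <= e -> x <= y + e -> x - e <= y)%E.
Proof.
(* For [e = +oo] the left side is [-oo], so finiteness of the error term need not be checked. *)
by case: e => [r _ H| |//]; [rewrite leeBlDr|rewrite addeNy leNye].
Qed.

Theorem lemma4p3 (R : realType) (dX dY : measure_display)
    (X : measurableType dX) (Y : measurableType dY)
    (nu : probability X R) (mu : R.-pker X ~> Y)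
    (n : nat) (n_gt0 : (0 < n)%N)
    (u : 'I_n -> X * Y -> R) (mu_u : forall i, measurable_fun setT (u i))
    (phi : forall d : nat, X * Y -> d.-tuple R)
    (mphi : forall d, measurable_fun setT (phi d))
    (sub_G : forall d,
      g_sigma_algebra_preimage (pair_emb (phi d)) `<=`
      g_sigma_algebra_preimage (pair_emb (phi d.+1)))
    (phi0_cst : forall w w' : X * Y, phi 0%N w = phi 0%N w')
    (pt : nat -> X * (Y * Y) -> R)
    (ptP : forall d, is_emb_pref nu mu (phi d) (mean_pref u) (pt d))
    (delta : R) (delta_gt0 : 0 < delta) (delta_lt : delta < 4^-1) :
  let lower (d : nat) : \bar R :=
    (Pbar_inf nu mu (2 * delta) (mean_pref u) pt
     - (3 / delta ^+ 2)%:E * mse nu mu (mean_pref u) (pt d))%E in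
  [/\ Pbar nu mu delta pt 0 = 0%E,
      forall d : nat, (lower d <= Pbar nu mu delta pt d)%E
    & nondecreasing_seq lower].
Proof.
move=> lower.
have mp := measurable_mean_pref mu_u.
have p01 := mean_pref_itv n_gt0 u.
pose qt d : X * (Y * Y) -> R := clamp01 \o pt d.
have mpt d : measurable_fun setT (pt d) by case: (ptP d).
have q01 d w : 0 <= qt d w <= 1 by exact: clamp01_itv.
have qtP d : is_emb_pref nu mu (phi d) (mean_pref u) (qt d).
  by have [] := emb_pref_clamp01 mp p01 (mphi d) (ptP d).
have ptqt d : fiberwise_ae_eq nu mu (pt d) (qt d).
  by have [] := emb_pref_clamp01 mp p01 (mphi d) (ptP d).
have mqt d : measurable_fun setT (qt d) by case: (qtP d).
have mseE d : mse nu mu (mean_pref u) (pt d) = mse nu mu (mean_pref u) (qt d).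
  exact: mse_ae_eq.
have pp : fiberwise_ae_eq nu mu (mean_pref u) (mean_pref u).
  apply: aeW => x; have [P Px] := pkerP mu x; rewrite -Px.
  exact: (aeW (P \x P)%E).
have c0 : 0 <= 3 / delta ^+ 2 by rewrite divr_ge0 ?sqr_ge0.
split.
- exact: (cyc_kappa_const mp p01 (mean_pref_swap n_gt0 u) phi0_cst (ptP 0%N) delta_gt0).
- move=> d; rewrite /lower mseE /Pbar.
  rewrite (cyc_kappa_ae_eq delta (mpt d) (mpt d) (mqt d) (mqt d) (ptqt d) (ptqt d)).
  (* The infimum is bounded by its term of index [d], rewritten with the truncated version
     [qt d]. *)
  apply: (@le_trans _ _ (cyc_kappa nu mu (2 * delta) (qt d) (mean_pref u)
      - (3 / delta ^+ 2)%:E * mse nu mu (mean_pref u) (qt d))%E).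
    rewrite -(cyc_kappa_ae_eq (2 * delta) (mpt d) mp (mqt d) mp (ptqt d) pp).
    by apply: leeB; [apply: ereal_inf_lbound; exists d|exact: lexx].
  apply: leeBl_addr; last exact: (cyc_kappa_le_mse nu mu mp (mqt d) (q01 d) delta_gt0).
  apply: mule_ge0; first by rewrite lee_fin.
  by apply: integral_ge0 => x _; apply: ge0_int2 => z; rewrite lee_fin sqr_ge0.
(* Only the subtracted error depends on [d], so the claim reduces to its decrease from [d] to
   [d.+1]. *)
- apply/nondecreasing_seqP => d; rewrite /lower !mseE; apply: leeB; first exact: lexx.
  apply: lee_wpmul2l; first by rewrite lee_fin.
  exact: (mse_emb_pref_mono mp p01 (mphi d.+1) (sub_G d) (qtP d)
    (qtP d.+1) (q01 d) (q01 d.+1)).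
Qed.
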